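(* Let $N\ge1$ be an integer and $\lambda_1,\lambda_2\in\mathbb{C}$ with $\lambda_1,\lambda_2\notin\{0,-1,\dots,-(N-1)\}$ and $\lambda_1+\lambda_2\notin\{0,-1,\dots,-(2N-2)\}$. The assignment \[X\mapsto\frac12N(1-v)-\frac{(1-v)(1+v)}{2}\partial_v,\qquad Y\mapsto\Phi^{\lambda_1,\lambda_2}_v\] of differential operators in the variable $v$ is a representation of the Hahn algebra with parameters $\lambda_1,\lambda_2,N$.
   Context: The Jacobi operator is $\Phi^{\lambda,\lambda'}_v=(v^2-1)\partial_v^2+\bigl(\lambda-\lambda'+(\lambda+\lambda')v\bigr)\partial_v$. The operators act on polynomials in $v$. The Hahn algebra with parameters $\lambda_1,\lambda_2,N$ is generated by $X,Y$ with relations (where $\{X,Y\}=XY+YX$): \[[X,Y]=Z,\] \[[X,Z]=2X^2+(\lambda_1-\lambda_2-2N)X+Y-\lambda_1N,\] \[[Y,Z]=-2\{X,Y\}-(\lambda_1+\lambda_2)(\lambda_1+\lambda_2-2)X-(\lambda_1-\lambda_2-2N)Y+\lambda_1(\lambda_1+\lambda_2-2)N.\] *)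

(* Defs.v *)
From HB Require Import structures.
From mathcomp Require Import all_boot all_order all_algebra.
From mathcomp Require Import boolp ring.
From mathcomp Require Import monalg.

Set Implicit Arguments.
Unset Strict Implicit.
Unset Printing Implicit Defensive.
Import Order.TTheory GRing.Theory Num.Theory.
Local Open Scope ring_scope.
Local Open Scope quotient_scope.

Definition commutator (A : pzRingType) (a b : A) : A := a * b - b * a.
Definition anticommutator (A : pzRingType) (a b : A) : A := a * b + b * a.

Inductive two_sided_ideal (A : pzRingType) (S : A -> Prop) : A -> Prop :=
| tsi_gen a : S a -> two_sided_ideal S a
| tsi0 : two_sided_ideal S 0
| tsiB a b : two_sided_ideal S a -> two_sided_ideal S b ->
    two_sided_ideal S (a - b)
| tsiMl a b : two_sided_ideal S b -> two_sided_ideal S (a * b)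
| tsiMr a b : two_sided_ideal S a -> two_sided_ideal S (a * b).

(* Left-hand side minus right-hand side of the last two Hahn relations; the
   first one, [X, Y] = Z, only names Z. *)
Section Relations.
Variables (K : comNzRingType) (l1 l2 : K) (N : nat) (A : lalgType K) (X Y : A).

Definition hahn_rel1 : A :=
  let Z := commutator X Y in
  commutator X Z
  - (2 *: X ^+ 2 + (l1 - l2 - 2 * N%:R) *: X + Y - (l1 * N%:R)%:A).

Definition hahn_rel2 : A :=
  let Z := commutator X Y in
  commutator Y Z
  - (- (2 *: anticommutator X Y)
     - ((l1 + l2) * (l1 + l2 - 2)) *: X
     - (l1 - l2 - 2 * N%:R) *: Y
     + (l1 * (l1 + l2 - 2) * N%:R)%:A).

End Relations.

Fact hahn_rel_eval (K : comNzRingType) (l1 l2 : K) (N : nat)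
    (A : lalgType K) (f : A -> K) (X Y : A) :
  {morph f : a b / a + b} -> {morph f : a / - a} -> {morph f : a b / a * b} ->
  (forall k, {morph f : a / k *: a >-> k * a}) -> f 1 = 1 ->
  f (hahn_rel1 l1 l2 N X Y) = l1 * N%:R
    - (2 * f X ^+ 2 + (l1 - l2 - 2 * N%:R) * f X + f Y) /\
  f (hahn_rel2 l1 l2 N X Y) = 4 * f X * f Y
    + (l1 + l2) * (l1 + l2 - 2) * f X + (l1 - l2 - 2 * N%:R) * f Y
    - l1 * (l1 + l2 - 2) * N%:R.
Proof.
move=> fD fN fM fZ f1.
rewrite /hahn_rel1 /hahn_rel2 /commutator /anticommutator expr2.
by rewrite !(fD, fN, fM, fZ, f1); split; ring.
Qed.

(* The Hahn algebra is the free associative algebra on two letters X and Y,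
   encoded as 0 and 1 in 'I_2, modulo the two-sided ideal generated by the
   relations. *)
Section HahnAlgebra.
Variable K : numClosedFieldType.

Definition free_alg2 := {malg K[{fmonom 'I_2}]}.
HB.instance Definition _ := GRing.Lalgebra.on free_alg2.

Definition free_X : free_alg2 := << fmu (0 : 'I_2) >>.
Definition free_Y : free_alg2 := << fmu (1 : 'I_2) >>.

Fact free_alg2_scalerAr (k : K) (a b : free_alg2) : k *: (a * b) = a * (k *: b).
Proof.
have malgC_comm (c : K) (g : free_alg2) : g * c%:MP = c%:MP * g.
  rewrite [LHS]fgmulgU [RHS]fgmulUg; apply: eq_bigr => m _.
  by rewrite mulm1 mul1m mulrC.
by rewrite -!mul_malgC mulrA -malgC_comm mulrA.
Qed.
HB.instance Definition _ :=
  GRing.Lalgebra_isAlgebra.Build K free_alg2 free_alg2_scalerAr.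

Variables (l1 l2 : K) (N : nat).

Definition hahn_relators (a : free_alg2) : Prop :=
  a = hahn_rel1 l1 l2 N free_X free_Y \/ a = hahn_rel2 l1 l2 N free_X free_Y.

Definition hahn_ideal : {pred free_alg2} :=
  fun a => `[< two_sided_ideal hahn_relators a >].

Fact hahn_ideal_zmod_closed : zmod_closed hahn_ideal.
Proof.
split=> [|a b]; first exact/asboolP/tsi0.
by move=> /asboolP ha /asboolP hb; exact/asboolP/tsiB.
Qed.
HB.instance Definition _ :=
  GRing.isZmodClosed.Build free_alg2 hahn_ideal hahn_ideal_zmod_closed.

Fact hahn_idealMl a b : b \in hahn_ideal -> a * b \in hahn_ideal.
Proof. by move=> /asboolP hb; exact/asboolP/tsiMl. Qed.

Fact hahn_idealMr a b : a \in hahn_ideal -> a * b \in hahn_ideal.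
Proof. by move=> /asboolP ha; exact/asboolP/tsiMr. Qed.

(* The ideal is proper: the relations have a common solution in K, obtained
   from a root of a cubic. *)
Section Proper.
Variables x y : K.

Let letter (i : 'I_2) : K := if i == 0 then x else y.
Let word (m : {fmonom 'I_2}) : K := \prod_(i <- m) letter i.

Let word_morphism : mmorphism word.
Proof. by split=> [m n|]; rewrite /word ?fm1 ?big_nil // fmM big_cat. Qed.

HB.instance Definition _ :=
  isMultiplicative.Build {fmonom 'I_2} K word word_morphism.

Definition hahn_eval (a : free_alg2) : K := mmap idfun word a.

Fact hahn_evalD : {morph hahn_eval : a b / a + b}.
Proof. exact: rmorphD. Qed.
Fact hahn_evalN : {morph hahn_eval : a / - a}.
Proof. exact: rmorphN. Qed.
Fact hahn_evalM : {morph hahn_eval : a b / a * b}.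
Proof. exact: rmorphM. Qed.
Fact hahn_evalZ k : {morph hahn_eval : a / k *: a >-> k * a}.
Proof. by move=> a; exact: mmapZ. Qed.
Fact hahn_eval1 : hahn_eval 1 = 1.
Proof. exact: rmorph1. Qed.
Fact hahn_evalX : hahn_eval free_X = x.
Proof. by rewrite /hahn_eval /free_X mmapU mul1r /= /word fmU big_seq1. Qed.
Fact hahn_evalY : hahn_eval free_Y = y.
Proof. by rewrite /hahn_eval /free_Y mmapU mul1r /= /word fmU big_seq1. Qed.

End Proper.

Fact hahn_relators_root : exists x y : K,
  forall a, hahn_relators a -> hahn_eval x y a = 0.
Proof.
pose b := l1 - l2 - 2 * N%:R; pose s := l1 + l2.
pose c (i : nat) : K := nth 0 [:: - (l1 * N%:R * (s - 2 - b));
  s * (s - 2) + 4 * (l1 * N%:R) - b ^+ 2; - (6 * b)] i / 8.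
have [x] := @solve_monicpoly K 3 c isT.
rewrite !big_ord_recl big_ord0 /c /= expr0 expr1 => xP.
pose y := l1 * N%:R - 2 * x ^+ 2 - b * x.
have [r1 r2] := hahn_rel_eval l1 l2 N free_X free_Y (@hahn_evalD x y)
  (@hahn_evalN x y) (@hahn_evalM x y) (@hahn_evalZ x y) (hahn_eval1 x y).
exists x, y => _ [->|->]; rewrite (r1, r2) hahn_evalX hahn_evalY /y.
  by rewrite /b; ring.
have {}xP : 8 * x ^+ 3 = - (l1 * N%:R * (s - 2 - b))
    + (s * (s - 2) + 4 * (l1 * N%:R) - b ^+ 2) * x - 6 * b * x ^+ 2.
  by rewrite xP /bump /= addn0; field.
transitivity (- (8 * x ^+ 3 - (- (l1 * N%:R * (s - 2 - b))
    + (s * (s - 2) + 4 * (l1 * N%:R) - b ^+ 2) * x - 6 * b * x ^+ 2))).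
  by rewrite /b /s; ring.
by rewrite xP subrr oppr0.
Qed.

Fact hahn_ideal1 : 1 \notin hahn_ideal.
Proof.
have [x [y xyP]] := hahn_relators_root.
apply/negP => /asboolP h; suff: hahn_eval x y 1 = 0.
  by move/eqP; rewrite hahn_eval1 oner_eq0.
elim: h => [a /xyP //||a b _ ha _ hb|a b _ hb|a b _ ha].
- by rewrite -(subrr 1) hahn_evalD hahn_evalN subrr.
- by rewrite hahn_evalD hahn_evalN ha hb subrr.
- by rewrite hahn_evalM hb mulr0.
- by rewrite hahn_evalM ha mul0r.
Qed.

Definition hahn_algebra : Type := {ideal_quot hahn_ideal}.
HB.instance Definition _ := GRing.Zmodule.on hahn_algebra.
HB.instance Definition _ := EqQuotient.on hahn_algebra.

Definition hahn_pi (a : free_alg2) : hahn_algebra := \pi a.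

Fact hahn_piP (q : hahn_algebra) : exists a, q = hahn_pi a.
Proof. by exists (repr q); rewrite /hahn_pi reprK. Qed.

Fact hahn_pi_eq a b : (hahn_pi a = hahn_pi b) <-> (a - b \in hahn_ideal).
Proof. by rewrite Quotient.idealrBE; split=> /eqP. Qed.

Fact hahn_piD : {morph hahn_pi : a b / a + b}.
Proof. by move=> a b; rewrite /hahn_pi raddfD. Qed.

Fact hahn_pi0 : hahn_pi 0 = 0.
Proof. by apply: (addrI (hahn_pi 0)); rewrite -hahn_piD !addr0. Qed.

Definition hahn_one : hahn_algebra := hahn_pi 1.
Definition hahn_mul (p q : hahn_algebra) : hahn_algebra :=
  hahn_pi (repr p * repr q).
Definition hahn_scale (k : K) (p : hahn_algebra) : hahn_algebra :=
  hahn_pi (k *: repr p).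

Fact hahn_repr_pi a : repr (hahn_pi a) - a \in hahn_ideal.
Proof. by apply/hahn_pi_eq; rewrite /hahn_pi reprK. Qed.

Fact hahn_piM a b : hahn_pi (a * b) = hahn_mul (hahn_pi a) (hahn_pi b).
Proof.
apply/esym/hahn_pi_eq.
rewrite -[_ * _](subrK (a * repr (hahn_pi b))) -mulrBl -addrA -mulrBr.
apply: rpredD; first exact/hahn_idealMr/hahn_repr_pi.
exact/hahn_idealMl/hahn_repr_pi.
Qed.

Fact hahn_piZ k a : hahn_pi (k *: a) = hahn_scale k (hahn_pi a).
Proof.
apply/esym/hahn_pi_eq.
by rewrite -scalerBr -mulr_algl hahn_idealMl ?hahn_repr_pi.
Qed.

Fact hahn_mulA : associative hahn_mul.
Proof.
move=> p q r; have [[a ->] [b ->] [c ->]] :=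
  And3 (hahn_piP p) (hahn_piP q) (hahn_piP r).
by rewrite -!hahn_piM mulrA.
Qed.

Fact hahn_mul1 : left_id hahn_one hahn_mul.
Proof. by move=> p; have [a ->] := hahn_piP p; rewrite -hahn_piM mul1r. Qed.

Fact hahn_mulr1 : right_id hahn_one hahn_mul.
Proof. by move=> p; have [a ->] := hahn_piP p; rewrite -hahn_piM mulr1. Qed.

Fact hahn_mulDl : left_distributive hahn_mul +%R.
Proof.
move=> p q r; have [[a ->] [b ->] [c ->]] :=
  And3 (hahn_piP p) (hahn_piP q) (hahn_piP r).
by rewrite -hahn_piD -!hahn_piM -hahn_piD mulrDl.
Qed.

Fact hahn_mulDr : right_distributive hahn_mul +%R.
Proof.
move=> p q r; have [[a ->] [b ->] [c ->]] :=
  And3 (hahn_piP p) (hahn_piP q) (hahn_piP r).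
by rewrite -hahn_piD -!hahn_piM -hahn_piD mulrDr.
Qed.

Fact hahn_one_neq0 : hahn_one != 0.
Proof.
apply: contra hahn_ideal1 => /eqP; rewrite -hahn_pi0 => /hahn_pi_eq.
by rewrite subr0.
Qed.

HB.instance Definition _ := GRing.Zmodule_isNzRing.Build hahn_algebra
  hahn_mulA hahn_mul1 hahn_mulr1 hahn_mulDl hahn_mulDr hahn_one_neq0.

Fact hahn_scaleA a b p : hahn_scale a (hahn_scale b p) = hahn_scale (a * b) p.
Proof. by have [x ->] := hahn_piP p; rewrite -!hahn_piZ scalerA. Qed.

Fact hahn_scale1 : left_id 1 hahn_scale.
Proof. by move=> p; have [x ->] := hahn_piP p; rewrite -hahn_piZ scale1r. Qed.

Fact hahn_scaleDr : right_distributive hahn_scale +%R.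
Proof.
move=> k p q; have [[a ->] [b ->]] := conj (hahn_piP p) (hahn_piP q).
by rewrite -hahn_piD -!hahn_piZ -hahn_piD scalerDr.
Qed.

Fact hahn_scaleDl p : {morph hahn_scale^~ p : a b / a + b}.
Proof.
by move=> a b; have [x ->] := hahn_piP p; rewrite -!hahn_piZ -hahn_piD scalerDl.
Qed.

HB.instance Definition _ := GRing.Zmodule_isLmodule.Build K hahn_algebra
  hahn_scaleA hahn_scale1 hahn_scaleDr hahn_scaleDl.

Fact hahn_scaleAl (k : K) (p q : hahn_algebra) : k *: (p * q) = (k *: p) * q.
Proof.
have [[a ->] [b ->]] := conj (hahn_piP p) (hahn_piP q).
rewrite -[RHS]/(hahn_mul (hahn_scale k _) _).
rewrite -[LHS]/(hahn_scale k (hahn_mul _ _)).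
by rewrite -hahn_piZ -!hahn_piM -hahn_piZ scalerAl.
Qed.
HB.instance Definition _ :=
  GRing.Lmodule_isLalgebra.Build K hahn_algebra hahn_scaleAl.

Fact hahn_scaleAr (k : K) (p q : hahn_algebra) : k *: (p * q) = p * (k *: q).
Proof.
have [[a ->] [b ->]] := conj (hahn_piP p) (hahn_piP q).
rewrite -[RHS]/(hahn_mul _ (hahn_scale k _)).
rewrite -[LHS]/(hahn_scale k (hahn_mul _ _)).
by rewrite -hahn_piZ -!hahn_piM -hahn_piZ scalerAr.
Qed.
HB.instance Definition _ :=
  GRing.Lalgebra_isAlgebra.Build K hahn_algebra hahn_scaleAr.

Definition hahn_X : hahn_algebra := hahn_pi free_X.
Definition hahn_Y : hahn_algebra := hahn_pi free_Y.

End HahnAlgebra.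

Record is_representation (K : comNzRingType) (A : algType K) (V : lmodType K)
    (rho : A -> {linear V -> V}) : Prop := IsRepresentation {
  repr_linear : forall (k : K) (a b : A) (v : V),
    rho (k *: a + b) v = k *: rho a v + rho b v;
  repr_one : forall v : V, rho 1 v = v;
  repr_mul : forall (a b : A) (v : V), rho (a * b) v = rho a (rho b v) }.

(* In the next two definitions 'X stands for the variable v. *)
Definition jacobi_op (K : fieldType) (l l' : K) (p : {poly K}) : {poly K} :=
  ('X ^+ 2 - 1) * p^`(2) + ((l - l')%:P + (l + l') *: 'X) * p^`().

Definition hahn_X_op (K : fieldType) (N : nat) (p : {poly K}) : {poly K} :=
  (2^-1 * N%:R) *: ((1 - 'X) * p) - 2^-1 *: ((1 - 'X) * (1 + 'X) * p^`()).

(* Main.v *)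
(* The free algebra on two letters acts on any module equipped with two linear
   operators, and the action descends to the Hahn algebra as soon as the
   operators satisfy the two Hahn relations. For the given differential
   operators each relation is a polynomial identity in v, the parameters, p and
   the derivatives of p. *)
From HB Require Import structures.
Require Import Defs.
From mathcomp Require Import all_boot all_order all_algebra.
From mathcomp Require Import reals complex ring finmap monalg.

Set Implicit Arguments.
Unset Strict Implicit.
Unset Printing Implicit Defensive.
Import GRing.Theory.

Local Open Scope ring_scope.

(** * Evaluation of the Hahn relators in an action by operators *)

Section RelationAction.
Variables (K : comNzRingType) (A : lalgType K) (V : lmodType K).
Variables (act : A -> V -> V) (x y : A) (X Y : V -> V) (l1 l2 : K) (N : nat).
Hypothesis actD : forall a b v, act (a + b) v = act a v + act b v.
Hypothesis actN : forall a v, act (- a) v = - act a v.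
Hypothesis actZ : forall k a v, act (k *: a) v = k *: act a v.
Hypothesis actM : forall a b v, act (a * b) v = act a (act b v).
Hypothesis act1 : forall v, act 1 v = v.
Hypothesis actx : forall v, act x v = X v.
Hypothesis acty : forall v, act y v = Y v.
Let Z v := X (Y v) - Y (X v).

(** The action enters only through its laws, which turn sums and products inside the relator into
    sums and composites of operators. *)
Lemma act_hahn_rel1 v : act (hahn_rel1 l1 l2 N x y) v = X (Z v) - Z (X v)
  - (2 *: X (X v) + (l1 - l2 - 2 * N%:R) *: X v + Y v - (l1 * N%:R) *: v).
Proof.
rewrite /hahn_rel1 /commutator expr2 /Z.
by rewrite !(actD, actN, actZ, actM, act1, actx, acty).
Qed.

Lemma act_hahn_rel2 v : act (hahn_rel2 l1 l2 N x y) v = Y (Z v) - Z (Y v)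
  - (- (2 *: (X (Y v) + Y (X v))) - ((l1 + l2) * (l1 + l2 - 2)) *: X v
     - (l1 - l2 - 2 * N%:R) *: Y v + (l1 * (l1 + l2 - 2) * N%:R) *: v).
Proof.
rewrite /hahn_rel2 /commutator /anticommutator /Z.
by rewrite !(actD, actN, actZ, actM, act1, actx, acty).
Qed.

End RelationAction.

(** * Action of the free algebra and its descent to the Hahn algebra *)

Section FreeAction.
Variables (K : numClosedFieldType) (V : lmodType K) (X Y : {linear V -> V}).

(** The first letter is applied last, so concatenation of words becomes composition. *)
Definition word_act (s : seq 'I_2) (v : V) : V :=
  foldr (fun i w => if i == 0 then X w else Y w) v s.

Fact word_act_is_linear s : linear (word_act s).
Proof.
rewrite /word_act; elim: s => //= i s IHs k u v; rewrite IHs.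
by case: ifP => _; rewrite linearP.
Qed.
HB.instance Definition _ s :=
  GRing.isLinear.Build K V V *:%R (word_act s) (word_act_is_linear s).

Definition free_act (a : free_alg2 K) (v : V) : V :=
  \sum_(m <- msupp a) a@_m *: word_act m v.

Fact free_act_is_linear a : linear (free_act a).
Proof.
move=> k u v; rewrite /free_act scaler_sumr -big_split; apply: eq_bigr => m _.
by rewrite linearP scalerDr !scalerA mulrC.
Qed.
HB.instance Definition _ a :=
  GRing.isLinear.Build K V V *:%R (free_act a) (free_act_is_linear a).

(** Words outside the support have coefficient 0. A common index set [d] is what allows sums over
    different supports to be compared. *)
Lemma free_actEw (d : {fset {fmonom 'I_2}}) (a : free_alg2 K) v :
  (msupp a `<=` d)%fset -> free_act a v = \sum_(m <- d) a@_m *: word_act m v.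
Proof.
move=> le_d; rewrite [LHS](big_fset_incl _ le_d) => //= m _ /mcoeff_outdom ->.
exact: scale0r.
Qed.

Lemma free_actU c (m : {fmonom 'I_2}) v :
  free_act << c *g m >> v = c *: word_act m v.
Proof. by rewrite (free_actEw _ msuppU_le) big_seq_fset1 mcoeffUU. Qed.

Lemma free_actD v : {morph free_act^~ v : a b / a + b}.
Proof.
move=> a b; rewrite (free_actEw _ (msuppD_le _ _)).
rewrite (free_actEw v (fsubsetUl _ (msupp b))).
rewrite (free_actEw v (fsubsetUr (msupp a) _)) -big_split.
by apply: eq_bigr => m _; rewrite mcoeffD scalerDl.
Qed.

Lemma free_actZ k (a : free_alg2 K) v : free_act (k *: a) v = k *: free_act a v.
Proof.
rewrite (free_actEw _ (msuppZ_le _ _)) scaler_sumr.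
by apply: eq_bigr => m _; rewrite mcoeffZ scalerA.
Qed.

Lemma free_actN v : {morph free_act^~ v : a / - a}.
Proof. by move=> a; rewrite -!scaleN1r free_actZ. Qed.

Lemma free_act0 v : free_act 0 v = 0.
Proof. by rewrite -[0](subrr 1) free_actD free_actN subrr. Qed.

Lemma free_act1 v : free_act 1 v = v.
Proof. by rewrite free_actU scale1r /word_act fm1. Qed.

Lemma free_actM a b v : free_act (a * b) v = free_act a (free_act b v).
Proof.
rewrite malgME (big_morph _ (free_actD v) (free_act0 v)).
apply: eq_bigr => m _; rewrite (big_morph _ (free_actD v) (free_act0 v)).
rewrite linear_sum scaler_sumr; apply: eq_bigr => n _.
by rewrite free_actU linearZ scalerA /word_act fmM foldr_cat.
Qed.

Lemma free_act_X v : free_act (free_X K) v = X v.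
Proof. by rewrite free_actU scale1r /word_act fmU. Qed.

Lemma free_act_Y v : free_act (free_Y K) v = Y v.
Proof. by rewrite free_actU scale1r /word_act fmU. Qed.

Variables (l1 l2 : K) (N : nat).
Let Z v := X (Y v) - Y (X v).

Hypothesis XZ : forall v, X (Z v) - Z (X v) =
  2 *: X (X v) + (l1 - l2 - 2 * N%:R) *: X v + Y v - (l1 * N%:R) *: v.
Hypothesis YZ : forall v, Y (Z v) - Z (Y v) =
  - (2 *: (X (Y v) + Y (X v))) - ((l1 + l2) * (l1 + l2 - 2)) *: X v
  - (l1 - l2 - 2 * N%:R) *: Y v + (l1 * (l1 + l2 - 2) * N%:R) *: v.

(** Induction on the generation of the ideal: [XZ] and [YZ] kill the relators, and products act by
    composition of linear maps, so a zero factor on either side gives zero. *)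
Lemma free_act_ideal a v : a \in hahn_ideal l1 l2 N -> free_act a v = 0.
Proof.
have actD b c w := free_actD w b c; have actN b w := free_actN w b.
move=> /boolp.asboolP h.
elim: h v => {a} [a [->|->]||a b _ IHa _ IHb|a b _ IHb|a b _ IHa] v.
- by rewrite (act_hahn_rel1 _ _ _ actD actN free_actZ free_actM free_act1
    free_act_X free_act_Y) XZ subrr.
- by rewrite (act_hahn_rel2 _ _ _ actD actN free_actZ free_actM free_act1
    free_act_X free_act_Y) YZ subrr.
- exact: free_act0.
- by rewrite free_actD free_actN IHa IHb subrr.
- by rewrite free_actM IHb linear0.
- by rewrite free_actM IHa.
Qed.

(** Acting through a chosen representative inherits linearity in the vector from [free_act]. *)
Definition hahn_act (q : hahn_algebra l1 l2 N) : {linear V -> V} :=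
  free_act (repr q).

(** The chosen representative differs from [a] by an element of the ideal, which acts as zero. *)
Lemma hahn_act_pi a v : hahn_act (hahn_pi l1 l2 N a) v = free_act a v.
Proof.
apply/eqP; rewrite -subr_eq0 /= -free_actN -free_actD.
exact/eqP/free_act_ideal/hahn_repr_pi.
Qed.

Lemma hahn_act_representation : is_representation hahn_act.
Proof.
split=> [k p q v|v|p q v].
- have [[a ->] [b ->]] := conj (hahn_piP p) (hahn_piP q).
  (* The structure operation is exposed as [hahn_scale] so that it can be moved inside [hahn_pi]. *)
  rewrite -[_ *: _]/(hahn_scale k _) -hahn_piZ -hahn_piD !hahn_act_pi.
  by rewrite free_actD free_actZ.
- by rewrite -[1]/(hahn_one _ _ _) hahn_act_pi free_act1.
- have [[a ->] [b ->]] := conj (hahn_piP p) (hahn_piP q).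
  by rewrite -[_ * _]/(hahn_mul _ _) -hahn_piM !hahn_act_pi free_actM.
Qed.

End FreeAction.

(** * Linearity of the two differential operators *)

Section JacobiOperators.
Variables (K : fieldType) (N : nat) (l l' : K).

Fact jacobi_op_is_linear : linear (@jacobi_op K l l').
Proof.
move=> k p q; rewrite /jacobi_op /= !derivD !derivZ -!mul_polyC.
ring.
Qed.
HB.instance Definition _ := GRing.isLinear.Build K {poly K} {poly K} *:%R
  (jacobi_op l l') jacobi_op_is_linear.

Fact hahn_X_op_is_linear : linear (@hahn_X_op K N).
Proof.
move=> k p q; rewrite /hahn_X_op derivD derivZ -!mul_polyC.
ring.
Qed.
HB.instance Definition _ := GRing.isLinear.Build K {poly K} {poly K} *:%R
  (@hahn_X_op K N) hahn_X_op_is_linear.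
End JacobiOperators.

(** * The Hahn relations for the differential operators *)

Section JacobiRelations.
Variables (K : fieldType) (N : nat) (l1 l2 : K).
Hypothesis two_neq0 : 2 != 0 :> K.
Local Notation X := (@hahn_X_op K N).
Local Notation Y := (jacobi_op l1 l2).
Let Z p := X (Y p) - Y (X p).
Let h : {poly K} := (2^-1)%:P.
Let n : {poly K} := N%:R%:P.
Let a : {poly K} := (l1 - l2)%:P.
Let s : {poly K} := (l1 + l2)%:P.

Let two_h : 2 * h = 1.
Proof. by rewrite -polyC_natr -polyCM mulfV. Qed.

Let derivE := (derivD, derivN, derivM, derivX, derivC).

(* Constants are kept under [polyC] so that [derivC] applies to them. *)
Let hahn_X_opE p :
  X p = h * (n * (1%:P - 'X) * p - (1%:P - 'X * 'X) * p^`()).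
Proof. by rewrite /hahn_X_op -!mul_polyC polyCM -/h -/n polyC1; ring. Qed.

Let jacobi_opE p : Y p = (a + s * 'X) * p^`() - (1%:P - 'X * 'X) * p^`()^`().
Proof.
rewrite /jacobi_op !derivnS derivn0 -!mul_polyC -/a -/s polyC1; ring.
Qed.

(** The third derivatives of [p] cancel in the commutator, leaving an operator of order two with a
    single factor [h]. *)
Let ZE p : Z p = h * (2%:P * 'X * (1%:P - 'X * 'X) * p^`()^`()
  + ((2%:P - 2%:P * n - s) * (1%:P - 'X * 'X)
     - 2%:P * 'X * (a + s * 'X)) * p^`() + n * (a + s * 'X) * p).
Proof.
rewrite /Z !(hahn_X_opE, jacobi_opE) /h /n /a /s !derivE -/h -/n -/a -/s.
rewrite !polyC_natr polyC1; ring.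
Qed.

(* [ring] does not know that [2 h = 1]: in the relations below the two sides
   differ by an explicit multiple [q] of [2 h - 1]. *)
Let addr_two_h (q r : {poly K}) : r = r + (2 * h - 1) * q.
Proof. by rewrite two_h subrr mul0r addr0. Qed.

Lemma hahn_relXZ p : X (Z p) - Z (X p) =
  2 *: X (X p) + (l1 - l2 - 2 * N%:R) *: X p + Y p - (l1 * N%:R) *: p.
Proof.
(* The left side has degree 2 in [h]. This multiple of [2 * h - 1] scales the [X p] term by [2 * h]
   and the last two terms by [4 * h ^+ 2], making the right side homogeneous of the same degree. *)
rewrite [RHS](addr_two_h ((l1 - l2 - 2 * N%:R) *: X p
  + (1 + 2 * h) * (Y p - (l1 * N%:R) *: p))).
rewrite !ZE !(hahn_X_opE, jacobi_opE) -!mul_polyC.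
(* Only [h] is folded back: [l1] also occurs alone, so [a] and [s] must stay expanded. *)
rewrite /h /n /a /s !derivE !(polyCM, polyCB, polyCD, polyC_natr, polyC1) -/h.
ring.
Qed.

Lemma hahn_relYZ p : Y (Z p) - Z (Y p) =
  - (2 *: (X (Y p) + Y (X p))) - ((l1 + l2) * (l1 + l2 - 2)) *: X p
  - (l1 - l2 - 2 * N%:R) *: Y p + (l1 * (l1 + l2 - 2) * N%:R) *: p.
Proof.
(* Here the left side has degree 1 in [h], so only the [Y p] and [p] terms need a factor [2 * h]. *)
rewrite [RHS](addr_two_h ((l1 * (l1 + l2 - 2) * N%:R) *: p
  - (l1 - l2 - 2 * N%:R) *: Y p)).
rewrite !ZE !(hahn_X_opE, jacobi_opE) -!mul_polyC.
rewrite /h /n /a /s !derivE !(polyCM, polyCB, polyCD, polyC_natr, polyC1) -/h.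
ring.
Qed.
End JacobiRelations.

(** * The representation on polynomials over the complex numbers *)

Theorem proposition3p9 (R : realType) (N : nat) (l1 l2 : R[i]) :
  (1 <= N)%N ->
  (forall k : nat, (k <= N - 1)%N -> l1 != - k%:R) ->
  (forall k : nat, (k <= N - 1)%N -> l2 != - k%:R) ->
  (forall k : nat, (k <= 2 * N - 2)%N -> l1 + l2 != - k%:R) ->
  exists rho : hahn_algebra l1 l2 N -> {linear {poly R[i]} -> {poly R[i]}},
    [/\ is_representation rho,
        forall p : {poly R[i]}, rho (hahn_X l1 l2 N) p = hahn_X_op N p &
        forall p : {poly R[i]}, rho (hahn_Y l1 l2 N) p = jacobi_op l1 l2 p].
Proof.
move=> _ _ _ _.
have two_neq0 : 2 != 0 :> R[i] by rewrite Num.Theory.pnatr_eq0.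
pose X : {linear {poly R[i]} -> {poly R[i]}} := hahn_X_op N.
pose Y : {linear {poly R[i]} -> {poly R[i]}} := jacobi_op l1 l2.
have XZ := @hahn_relXZ _ N l1 l2 two_neq0.
have YZ := @hahn_relYZ _ N l1 l2 two_neq0.
exists (@hahn_act _ _ X Y l1 l2 N).
split=> [|p|p]; first exact: hahn_act_representation.
- by rewrite hahn_act_pi // free_act_X.
- by rewrite hahn_act_pi // free_act_Y.
Qed.
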